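(* Let $X$ be a real Hilbert space, $g\in\Gamma_0(X)$, $h:X\to\mathbb{R}$ convex and differentiable with $L$-Lipschitz gradient, $L\in]0,+\infty[$, and $f=g+h$, with $f$ bounded from below. Let $\lambda\in]0,2L^{-1}[$, $x_0\in X$, and $x_{n+1}=\operatorname{prox}_{\lambda g}(x_n-\lambda\nabla h(x_n))$ for $n\in\mathbb{N}$ (the forward-backward algorithm). Assume that, for some $\Omega\subset X$: (a) $x_n\in\Omega$ for all $n\in\mathbb{N}$; (b) $f$ is $p$-Łojasiewicz on $\Omega$ with constant $c_{f,\Omega}$, for some $p\in[1,+\infty[$. Then $\sum_{n\in\mathbb{N}}\|x_{n+1}-x_n\|<+\infty$, $\operatorname{argmin} f\neq\emptyset$, and $(x_n)$ converges strongly to some $x_\infty\in\operatorname{argmin} f$. Moreover, set $r_n:=f(x_n)-\inf f$ and $\kappa:=\lambda(2-\lambda L)[2c_{f,\Omega}^2]^{-1}$. There exist constants $C_p,C_p'>0$ such that: (i) If $p=1$, then $x_n=x_\infty$ for every $n\ge r_0/\kappa$. (ii) If $p\in]1,2[$, then for all $n\in\mathbb{N}$: $r_{n+1}\le (r_n/\kappa)^{\frac{p}{2(p-1)}}$ and $\|x_{n+1}-x_\infty\|\le C_p\, r_n^{1/2}$. (iii) If $p=2$, then for all $n\in\mathbb{N}$: $r_{n+1}\le\frac{1}{1+\kappa}r_n$ and $\|x_{n+1}-x_\infty\|\le C_2\,r_0^{1/2}(1+\kappa)^{-n/2}$. (iv) If $p\in]2,+\infty[$, then for all $n\in\mathbb{N}$: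 $r_n\le (C_p')^{p/(p-2)}n^{-\frac{p}{p-2}}$ and $\|x_{n+1}-x_\infty\|\le C_p(C_p')^{1/(p-2)}n^{-\frac1{p-2}}$. When $0<r_0<+\infty$, these constants can be taken as follows, with $c:=c_{f,\Omega}$: $$C_p=\begin{cases}2pc(2-\lambda L)^{-1}+(2\lambda r_0)^{1/2}(2-\lambda L)^{-1/2}r_0^{-1/p}&\text{if }p\ge2,\\ 2pc\,r_0^{1/p}(2-\lambda L)^{-1}r_0^{-1/2}+(2\lambda)^{1/2}(2-\lambda L)^{-1/2}&\text{if }p\le2,\end{cases}$$ and, for $p>2$, $$(C_p')^{-1}=\min\left\{\kappa,\kappa^{\frac{p-2}{2p-2}}\right\}\max_{s\ge1}\min\left\{\frac{p-2}{ps},\ \kappa^{\frac{2-p}{2p-2}}r_0^{\frac{2-p}{p}}\left(1-s^{-\frac{p-2}{2p-2}}\right)\right\}.$$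
   Context: $\Gamma_0(X)$ is the set of proper, convex, lower semicontinuous functions $X\to]-\infty,+\infty]$. $\operatorname{prox}_{\lambda g}(x)=\operatorname{argmin}_{u\in X}\{g(u)+\frac1{2\lambda}\|u-x\|^2\}$. $\operatorname{dom}^*f:=\operatorname{dom} f\setminus\operatorname{argmin} f$; $\|\partial f(x)\|_-:=\operatorname{dist}(0,\partial f(x))$, equal to $+\infty$ if $\partial f(x)=\emptyset$, where $\partial f$ is the convex subdifferential. For $p\in[1,+\infty[$ and $f\in\Gamma_0(X)$ bounded from below, $f$ is $p$-Łojasiewicz on $\Omega$ with constant $c_{f,\Omega}>0$ if $(f(x)-\inf f)^{1-1/p}\le c_{f,\Omega}\|\partial f(x)\|_-$ for all $x\in\Omega\cap\operatorname{dom}^*f$. Right-hand sides are allowed to equal $+\infty$ (with $0^{-s}=+\infty$ for $s>0$; $r_0=+\infty$ if $x_0\notin\operatorname{dom} f$). *)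

(* Defs.v *)
From HB Require Import structures.
From mathcomp Require Export all_boot all_order all_algebra.
From mathcomp Require Export sesquilinear.
From mathcomp Require Export all_classical all_reals all_analysis.

Set Implicit Arguments.
Unset Strict Implicit.
Unset Printing Implicit Defensive.

Import Order.TTheory GRing.Theory Num.Theory.
Import numFieldNormedType.Exports.

Local Open Scope classical_set_scope.
Local Open Scope ring_scope.

(* A real Hilbert space is a [X : completeNormedModType R] with a positive
   definite symmetric bilinear form [dot : {dot X for idfun}] inducing its
   norm. *)
Definition induces_norm (R : realType) (X : normedModType R)
    (dot : {dot X for idfun}) : Prop :=
  forall u : X, `|u| ^+ 2 = dot u u.

(* [G] is the Riesz representative of the Frechet differential of [h]. *)
Definition is_gradient (R : realType) (X : normedModType R)
    (dot : {dot X for idfun}) (h : X -> R^o) (G : X -> X) : Prop :=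
  forall x : X, differentiable h x /\ forall v : X, 'd h x v = dot (G x) v.

Section extended_real_valued_functions.
Context {R : realType} {X : normedModType R}.
Implicit Types (f g : X -> \bar R) (x y : X).
Local Open Scope ereal_scope.

Definition edom f : set X := [set x | f x < +oo].

Definition einf f : \bar R := ereal_inf (range f).

Definition argmin f : set X := [set x | forall y, f x <= f y].

Definition bounded_below f : Prop := exists m : R, forall x, m%:E <= f x.

Definition proper f : Prop := (forall x, -oo < f x) /\ edom f !=set0.

(* Restricting [t] to the open interval ]0, 1[ avoids products 0 * +oo. *)
Definition econvex f : Prop :=
  forall (t : R) x y, (0 < t < 1)%R ->
    f (t *: x + (1 - t) *: y)%R <= t%:E * f x + (1 - t)%:E * f y.

Definition Gamma0 f : Prop :=
  [/\ proper f, econvex f & lower_semicontinuous f].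

(* For [g] in [Gamma0] and [0 < lambda] this set is a singleton, so that
   [prox lambda g x u] stands for the equation u = prox_{lambda g}(x). *)
Definition prox (lambda : R) g x : set X :=
  argmin (fun u => g u + ((2 * lambda)^-1 * `|u - x| ^+ 2)%:E).

Definition dom_star f : set X := edom f `\` argmin f.

(* For proper [f] this set is empty when [f x = +oo]. *)
Definition subdiff (dot : {dot X for idfun}) f x : set X :=
  [set u | forall y, f x + (dot u (y - x)%R)%:E <= f y].

(* The distance from 0 to the subdifferential; [ereal_inf set0 = +oo]. *)
Definition subdiff_norm (dot : {dot X for idfun}) f x : \bar R :=
  ereal_inf [set (`|u|)%:E | u in subdiff dot f x].

Definition lojasiewicz (dot : {dot X for idfun}) f (p : R) (Omega : set X)
    (c : R) : Prop :=
  (0 < c)%R /\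
  forall x, (Omega `&` dom_star f) x ->
    (f x - einf f) `^ (1 - p^-1) <= c%:E * subdiff_norm dot f x.

End extended_real_valued_functions.

(* [t ^ (- s)] for [0 <= t] and [0 < s], with the convention 0 ^ (- s) = +oo
   ([powR] has 0 `^ (- s) = 0). *)
Definition eneg_pow (R : realType) (t s : R) : \bar R :=
  if t == 0 then +oo%E else (t `^ (- s))%:E.

Definition is_maximum (R : realType) (A : set R) (m : R) : Prop :=
  A m /\ ubound A m.

(* Main.v *)
Require Import Defs.
From mathcomp Require Import all_boot all_order all_algebra sesquilinear.
From mathcomp Require Import all_classical all_reals all_analysis.
From mathcomp Require Import ring lra.

Set Implicit Arguments.
Unset Strict Implicit.
Unset Printing Implicit Defensive.

Import Order.TTheory GRing.Theory Num.Theory.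
Import numFieldNormedType.Exports.

Local Open Scope classical_set_scope.
Local Open Scope ring_scope.

(** Write [r n] for the gap [f (x n) - inf f] and [d n] for the step length
    [|x (n+1) - x n|]. Everything rests on two inequalities between them, with
    [a := (2 - lambda L) / (2 lambda)].

    - Sufficient decrease, [r (n+1) + a d n ^ 2 <= r n]: add the descent lemma
      for [h] to the subgradient inequality that characterizes the proximal
      point ([forward_backward_descent]).
    - A slope bound: [v := (x n - x (n+1)) / lambda - (grad h (x n) -
      grad h (x (n+1)))] is a subgradient of [f] at [x (n+1)], and
      [|v| <= d n / lambda]. The latter is where the whole range
      [lambda < 2 / L] is reached: the gradient step [id - lambda grad h] is
      nonexpansive because [grad h] is cocoercive (Baillon-Haddad, [cocoercive]).
      With the Lojasiewicz inequality it gives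
      [r (n+1) ^ (1 - 1/p) <= b d n] for [b := c / lambda].

    From here on the algorithm is forgotten: [dissipative a b p r d] records
    the two inequalities, and [kappa] is [a / b ^ 2]. Eliminating [d] leaves
    [kappa r (n+1) ^ (2 - 2/p) <= r n - r (n+1)]
    ([dissipative_recurrence]), from which [r n] tends to [0] with the rates of
    (i)-(iv). In the sublinear case one shows that [r n ^ (- (p - 2) / p)]
    grows at least linearly, and the constant is optimized over the threshold
    [s] that separates fast from slow decrease ([dissipative_power_step]).

    For the iterates, the concave function [t |-> p t ^ (1/p)] turns
    the two inequalities into
    [2 d (n+1) <= d n + (b/a) (p r (n+1) ^ (1/p) - p r (n+2) ^ (1/p))]
    ([dissipative_step]), which telescopes. Hence the trajectory has finite
    length, so it converges by completeness; its limit is a minimizer by lower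
    semicontinuity; and the distance from [x (n+1)] to the limit is bounded by
    powers of [r n] ([dissipative_dist_le]), from which the rates on the
    iterates follow.

    When [r 0 = +oo] only the sequence started at [x 1] is dissipative.
    Convergence is therefore always read off that shifted sequence, and the
    bounds at the first indices are either trivial or absorbed into a larger
    constant ([powR_shift_rate]). *)

(** * Tangent inequalities for real powers *)

Section power_tangents.
Context {R : realType}.
Implicit Types u v x s t : R.

Lemma ln_le_sub1 x : 0 < x -> ln x <= x - 1.
Proof.
move=> x0; have /le_ln1Dx : -1 < x - 1 by lra.
by rewrite addrC subrK.
Qed.

(** Concavity at [1]. Weighted by [s] and [1 - s], [ln z <= z - 1] at the
    points [x / m] and [1 / m], where [m] is the right-hand side, has a
    vanishing right-hand side by the choice of [m]. *)
Lemma powR_le_tangent x s : 0 <= x -> 0 < s <= 1 -> x `^ s <= 1 + s * (x - 1).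
Proof.
move=> x0 /andP[s0 s1]; have [->|xN0] := eqVneq x 0.
  by rewrite powR0 ?gt_eqF//; lra.
have {xN0}x0 : 0 < x by rewrite lt_neqAle eq_sym xN0.
set m := 1 + s * (x - 1).
have m0 : 0 < m by rewrite /m; nra.
have xm : ln (x / m) <= x / m - 1 by apply/ln_le_sub1/divr_gt0.
have im : ln m^-1 <= m^-1 - 1 by apply: ln_le_sub1; rewrite invr_gt0.
have e1 : s * (x / m - 1) + (1 - s) * (m^-1 - 1) = 0.
  by rewrite /m; field; rewrite gt_eqF.
rewrite -[leRHS]lnK// /powR gt_eqF// ler_expR.
move: xm im; rewrite ln_div// lnV// => xm im; nra.
Qed.

Lemma powRN_ge_tangent x s : 0 < x -> 0 <= s -> 1 - s * (x - 1) <= x `^ (- s).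
Proof.
move=> x0 s0; rewrite /powR gt_eqF//; apply: le_trans (expR_ge1Dx _).
by have := ln_le_sub1 x0; nra.
Qed.

(** The gradient inequality at [u] for the concave power [s], in the form in
    which it desingularizes the Lojasiewicz inequality. *)
Lemma powR_sub_ge u v s : 0 < u -> 0 <= v -> 0 < s <= 1 ->
  s * (u `^ (s - 1) * (u - v)) <= u `^ s - v `^ s.
Proof.
move=> u0 v0 s01.
have vu0 : 0 <= v / u by rewrite divr_ge0// ltW.
have := powR_le_tangent vu0 s01.
have -> : v `^ s = u `^ s * (v / u) `^ s.
  by rewrite -powRM// 1?ltW// mulrCA mulfV ?mulr1// gt_eqF.
have -> : u `^ (s - 1) = u `^ s / u.
  by rewrite powRB ?(lt0r_neq0 u0) ?implybT// powRr1// ltW.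
have -> : s * (u `^ s / u * (u - v)) = u `^ s * (s * (1 - v / u)).
  by field; rewrite gt_eqF.
by have := powR_gt0 s u0; nra.
Qed.

(** The gradient inequality at [u] for the convex power [- s]. *)
Lemma powRN_sub_ge u v s : 0 < u -> 0 < v -> 0 <= s ->
  s * (u `^ (- (s + 1)) * (u - v)) <= v `^ (- s) - u `^ (- s).
Proof.
move=> u0 v0 s0.
have vu0 : 0 < v / u by rewrite divr_gt0.
have := powRN_ge_tangent vu0 s0.
have -> : v `^ (- s) = u `^ (- s) * (v / u) `^ (- s).
  rewrite -powRM 1?ltW// ?(ltW vu0)// mulrCA mulfV ?mulr1// gt_eqF//.
have -> : u `^ (- (s + 1)) = u `^ (- s) / u.
  by rewrite opprD powRB ?(lt0r_neq0 u0) ?implybT// powRr1// ltW.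
have -> : s * (u `^ (- s) / u * (u - v)) = u `^ (- s) * (s * (1 - v / u)).
  by field; rewrite gt_eqF.
by have := powR_gt0 (- s) u0; nra.
Qed.

(** Lowers the exponent [s] to [t] at the price of a power of an upper bound
    [v]. Since [powR] sends [0] to [0] for every nonzero exponent, [u = 0] and
    even [v = 0] are covered. *)
Lemma powR_le_split u v s t : 0 <= u <= v -> 0 < t <= s ->
  u `^ s <= v `^ s * v `^ (- t) * u `^ t.
Proof.
move=> /andP[u0 uv] /andP[t0 ts].
have [->|uN0] := eqVneq u 0.
  by rewrite !powR0 ?gt_eqF ?mulr0//; exact: lt_le_trans ts.
have {uN0}u0 : 0 < u by rewrite lt_neqAle eq_sym uN0.
have v0 : 0 < v by apply: lt_le_trans uv.
have -> : u `^ s = u `^ (s - t) * u `^ t.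
  by rewrite -powRD ?(lt0r_neq0 u0) ?implybT// subrK.
rewrite ler_pM2r ?powR_gt0// -powRD ?(lt0r_neq0 v0) ?implybT//.
by apply: ge0_ler_powR; rewrite ?nnegrE ?subr_ge0 ?(ltW u0) ?(ltW v0).
Qed.

End power_tangents.

(** * Dissipative real sequences *)

Section dissipative_sequences.
Context {R : realType}.

(** What a descent method on a [p]-Lojasiewicz function leaves in real numbers:
    [rho] are the gaps to the minimal value, [d] the step lengths. The slope is
    measured at the end of the step, as for every implicit method. *)
Record dissipative (a b p : R) (rho d : nat -> R) : Prop := {
  dissipative_ge0 : forall n, 0 <= rho n ;
  dissipative_step_ge0 : forall n, 0 <= d n ;
  dissipative_decrease : forall n, rho n.+1 + a * d n ^+ 2 <= rho n ;
  dissipative_slope : forall n, 0 < rho n.+1 ->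
    rho n.+1 `^ (1 - p^-1) <= b * d n }.

Context {a b p : R} {rho d : nat -> R}.
Context (a0 : 0 < a) (b0 : 0 < b) (p1 : 1 <= p).
Context (H : dissipative a b p rho d).

Let rho0 := dissipative_ge0 H.
Let d0 := dissipative_step_ge0 H.
Let dec := dissipative_decrease H.
Let slope := dissipative_slope H.
Let kappa := a / b ^+ 2.

Let p0 : 0 < p. Proof. exact: lt_le_trans p1. Qed.
Let ip01 : 0 < p^-1 <= 1. Proof. by rewrite invr_gt0 p0/= invf_le1. Qed.
Let kappa0 : 0 < kappa. Proof. by rewrite divr_gt0// exprn_gt0. Qed.

Lemma dissipative_succ_le n : rho n.+1 <= rho n.
Proof. by have := dec n; have := mulr_ge0 (ltW a0) (sqr_ge0 (d n)); lra. Qed.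

Lemma dissipative_le m n : (m <= n)%N -> rho n <= rho m.
Proof.
move=> /subnK <-; elim: (n - m)%N => // k IH.
by rewrite addSn (le_trans (dissipative_succ_le _)).
Qed.

(** The slope condition bounds [d n] from below by a power of [rho n.+1];
    inserting it in the decrease condition eliminates [d]. *)
Lemma dissipative_recurrence n : 0 < rho n.+1 ->
  kappa * rho n.+1 `^ (2 * (1 - p^-1)) <= rho n - rho n.+1.
Proof.
move=> r0; have sl := slope r0.
rewrite mulrC powRrM powRAC powR_mulrn ?powR_ge0// mulrC.
have : a * d n ^+ 2 <= rho n - rho n.+1 by have := dec n; lra.
apply: le_trans; rewrite /kappa -mulrA ler_pM2l// mulrC ler_pdivrMr ?exprn_gt0//.
by rewrite -exprMn ler_sqr ?nnegrE ?powR_ge0// ?mulr_ge0 ?(ltW b0)// mulrC.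
Qed.

(** With [phi := p (rho n.+1 ^ (1/p) - rho n.+2 ^ (1/p))] concavity and the
    slope at [rho n.+1] give [rho n.+1 - rho n.+2 <= (b d n) phi], hence [d
    n.+1 ^ 2 <= d n (b/a) phi]; then apply the inequality of arithmetic and
    geometric means. *)
Lemma dissipative_step n : 2 * d n.+1 <=
  d n + b / a * (p * rho n.+1 `^ p^-1 - p * rho n.+2 `^ p^-1).
Proof.
set phi := _ - _.
have phi0 : 0 <= phi.
  rewrite /phi -mulrBr mulr_ge0 ?(ltW p0)// subr_ge0.
  apply: ge0_ler_powR; rewrite ?nnegrE// ?dissipative_succ_le//.
  by case/andP: ip01 => /ltW.
have [r0|r0] := ltP 0 (rho n.+1); last first.
  (* Once the gap vanishes, the decrease condition forbids any further step. *)
  have e : rho n.+1 = 0 by apply/eqP; rewrite eq_le r0 rho0.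
  have dle : d n.+1 ^+ 2 <= 0.
    by rewrite -(pmulr_rle0 _ a0); have := dec n.+1; have := rho0 n.+2; lra.
  have -> : d n.+1 = 0 by apply/eqP; rewrite -sqrf_eq0 eq_le dle sqr_ge0.
  by rewrite mulr0 addr_ge0// mulr_ge0// divr_ge0// ltW.
have sl := slope r0.
have phige : rho n.+1 `^ (p^-1 - 1) * (rho n.+1 - rho n.+2) <= phi.
  have := powR_sub_ge r0 (rho0 n.+2) ip01.
  by rewrite ler_pdivrMl// /phi -(mulrBr p).
set q := rho n.+1 `^ (1 - p^-1) in sl.
have q0 : 0 < q by rewrite powR_gt0.
have qV : rho n.+1 `^ (p^-1 - 1) = q^-1 by rewrite -powRN opprB.
have {phige} : rho n.+1 - rho n.+2 <= q * phi.
  by move: phige; rewrite qV mulrC ler_pdivrMr// mulrC.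
have := dec n.+1 => ? ?.
have sq : d n.+1 ^+ 2 <= d n * (b / a * phi).
  have -> : d n * (b / a * phi) = b * d n * phi / a by field; rewrite gt_eqF.
  by rewrite ler_pdivlMr//; nra.
set e := b / a * phi in sq *.
have e0 : 0 <= e by rewrite mulr_ge0// divr_ge0// ltW.
clearbody e.
rewrite -ler_sqr ?nnegrE ?addr_ge0 ?mulr_ge0//.
have := sqr_ge0 (d n - e); nra.
Qed.

(** Summing [dissipative_step] costs half of the length itself, whence the term
    [d k]. The slope is known at the ends of steps only, so the gap at [k.+1]
    appears. *)
Lemma dissipative_length k N :
  \sum_(i < N) d (k + i).+1 <= b / a * p * rho k.+1 `^ p^-1 + d k.
Proof.
(* The two boundary terms are those that make the induction telescope. *)
suff : \sum_(i < N) d (k + i).+1 + d (k + N)%N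
    + b / a * (p * rho (k + N).+1 `^ p^-1)
    <= d k + b / a * (p * rho k.+1 `^ p^-1).
  have : 0 <= b / a * (p * rho (k + N).+1 `^ p^-1).
    by rewrite !mulr_ge0 ?invr_ge0 ?powR_ge0// ltW.
  by have := d0 (k + N); rewrite -mulrA; lra.
elim: N => [|N IH]; first by rewrite big_ord0 add0r addn0.
rewrite big_ord_recr/= addnS.
by have := dissipative_step (k + N); nra.
Qed.

(** As long as the gap exceeds [e], the recurrence removes a fixed positive
    amount at each step, which a nonnegative sequence cannot sustain. *)
Lemma dissipative_min e : 0 < e -> exists n, rho n < e.
Proof.
move=> e0; apply: contrapT => /forallNP re.
have {}re n : e <= rho n by rewrite leNgt; apply/negP/re.
set s := 2 * (1 - p^-1).
have s0 : 0 <= s by rewrite /s; case/andP: ip01 => _ ?; lra.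
have step n : rho n.+1 <= rho n - kappa * e `^ s.
  have r0 : 0 < rho n.+1 by apply: lt_le_trans (re _).
  have := dissipative_recurrence r0; rewrite -/s.
  have : e `^ s <= rho n.+1 `^ s.
    by apply: ge0_ler_powR => //; rewrite nnegrE ltW.
  by rewrite -(ler_pM2l kappa0); lra.
have lin n : rho n <= rho 0%N - n%:R * (kappa * e `^ s).
  elim: n => [|n IH]; first by rewrite mul0r subr0.
  by rewrite -natr1 (le_trans (step n))//; lra.
have k0 : 0 < kappa * e `^ s by rewrite mulr_gt0 ?powR_gt0.
set N := (Num.truncn (rho 0%N / (kappa * e `^ s))).+1.
have : rho 0%N / (kappa * e `^ s) < N%:R by rewrite /N truncnS_gt.
rewrite ltr_pdivrMr// => hN.
by have := lin N; have := re N; lra.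
Qed.

Lemma dissipative_cvg : rho @ \oo --> (0 : R).
Proof.
apply/cvgrPdist_lt => e e0; have [n rn] := dissipative_min e0.
near=> m; rewrite sub0r normrN ger0_norm//; apply: le_lt_trans rn.
by apply: dissipative_le; near: m; exists n.
Unshelve. all: by end_near. Qed.

(** For [p = 1] the exponent in the recurrence is [0], so every step with a
    positive gap at its end removes at least [kappa]. *)
Lemma dissipative_finite n : p = 1 -> rho 0%N / kappa <= n%:R -> rho n = 0.
Proof.
move=> p_eq1; rewrite ler_pdivrMr// => hn.
have lin k : 0 < rho k -> rho k + k%:R * kappa <= rho 0%N.
  elim: k => [|k IH] r0; first by rewrite mul0r addr0.
  have := dissipative_recurrence r0.
  rewrite p_eq1 invr1 subrr mulr0 powRr0 mulr1 -natr1 => rec.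
  by have := IH (lt_le_trans r0 (dissipative_succ_le k)); lra.
apply/eqP; rewrite eq_le rho0 andbT leNgt; apply/negP => rn0.
by have := lin _ rn0; lra.
Qed.

(** Drop [- rho n.+1] from the recurrence and invert the power [2 - 2/p]. *)
Lemma dissipative_superlinear n : 1 < p ->
  rho n.+1 <= (rho n / kappa) `^ (p / (2 * (p - 1))).
Proof.
move=> p_gt1; have [r0|] := ltP 0 (rho n.+1); last first.
  by move=> /le_trans; apply; exact: powR_ge0.
set s := p / _.
have s0 : 0 < s by rewrite divr_gt0// mulr_gt0// subr_gt0.
have e : 2 * (1 - p^-1) * s = 1.
  by rewrite /s; field; rewrite !gt_eqF//; lra.
have -> : rho n.+1 = (rho n.+1 `^ (2 * (1 - p^-1))) `^ s.
  by rewrite -powRrM e powRr1// ltW.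
apply: ge0_ler_powR; rewrite ?nnegrE ?powR_ge0 ?(ltW s0)//.
  by rewrite divr_ge0// ltW.
rewrite ler_pdivlMr// mulrC.
by have := dissipative_recurrence r0; lra.
Qed.

Lemma dissipative_linear n : p = 2 -> rho n.+1 <= (1 + kappa)^-1 * rho n.
Proof.
move=> p_eq2; rewrite ler_pdivlMl ?addr_gt0//.
have [r0|r0] := ltP 0 (rho n.+1); last first.
  apply: le_trans (rho0 n); rewrite pmulr_rle0// addr_gt0//.
have := dissipative_recurrence r0.
have -> : 2 * (1 - p^-1) = 1 by rewrite p_eq2; field.
by rewrite powRr1 ?(ltW r0)//; lra.
Qed.

Lemma dissipative_geometric n :
  p = 2 -> rho n <= rho 0%N * (1 + kappa) `^ (- n%:R).
Proof.
move=> p_eq2; have k1 : 0 < 1 + kappa by rewrite addr_gt0.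
rewrite powR_invn ?(ltW k1)//.
elim: n => [|n IH]; first by rewrite expr0 invr1 mulr1.
apply: le_trans (dissipative_linear n p_eq2) _.
by rewrite exprS invfM mulrCA ler_pM2l ?invr_gt0.
Qed.

(** Put [beta := (p - 2) / p], so that the recurrence reads [kappa rho n.+1 ^
    (beta + 1) <= rho n - rho n.+1]. Either [rho n.+1 ^ (- (beta + 1))] is at
    most [s] times [rho n ^ (- (beta + 1))], and the gradient inequality for
    the power [- beta] at [rho n], combined with the recurrence, gives an
    increment [kappa beta / s]; or it is larger, and [rho n ^ (- beta)] is
    already multiplied by [s ^ theta], where [theta = beta / (beta + 1)]. *)
Lemma dissipative_power_step s n : 2 < p -> 1 <= s -> 0 < rho n.+1 ->
  Num.min kappa (kappa `^ ((p - 2) / (2 * p - 2))) *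
    Num.min ((p - 2) / (p * s))
     (kappa `^ ((2 - p) / (2 * p - 2)) * rho 0%N `^ ((2 - p) / p)
      * (1 - s `^ (- ((p - 2) / (2 * p - 2)))))
  <= rho n.+1 `^ (- ((p - 2) / p)) - rho n `^ (- ((p - 2) / p)).
Proof.
move=> p_gt2 s1 r0.
have rn0 : 0 < rho n by apply: lt_le_trans (dissipative_succ_le n).
have r00 : 0 < rho 0%N by apply: lt_le_trans rn0 (dissipative_le (leq0n _)).
have s0 : 0 < s by apply: lt_le_trans s1.
set th := (p - 2) / (2 * p - 2); set be := (p - 2) / p.
have th0 : 0 < th by rewrite divr_gt0//; lra.
have be0 : 0 < be by rewrite divr_gt0//; lra.
have -> : (2 - p) / (2 * p - 2) = - th by rewrite /th; field; rewrite gt_eqF//; lra.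
have -> : (2 - p) / p = - be by rewrite /be; field; rewrite gt_eqF.
have -> : (p - 2) / (p * s) = be / s by rewrite /be; field; rewrite !gt_eqF.
set K := Num.min kappa _; set m := Num.min (be / s) _.
have sth : s `^ (- th) <= 1.
  by rewrite powRN invf_le1 ?powR_gt0// -(powRr0 s) ler_powR// ltW.
have K0 : 0 <= K by rewrite le_min !ltW ?powR_gt0.
have m0 : 0 <= m.
  rewrite le_min divr_ge0 ?(ltW be0) ?(ltW s0)//=.
  by rewrite !mulr_ge0 ?powR_ge0// subr_ge0.
have [rs|rs] := leP (rho n.+1 `^ (- (be + 1))) (s * rho n `^ (- (be + 1))).
  have Kk : K <= kappa by rewrite ge_min lexx.
  have mb : m <= be / s by rewrite ge_min lexx.
  apply: le_trans (ler_pM K0 m0 Kk mb) _.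
  have := dissipative_recurrence r0.
  have -> : 2 * (1 - p^-1) = be + 1 by rewrite /be; field; rewrite gt_eqF.
  move=> rec; apply: le_trans (powRN_sub_ge rn0 r0 (ltW be0)).
  rewrite mulrCA ler_pM2l//.
  move: rs rec; rewrite powRN; set y := rho n `^ _; set x := rho n.+1 `^ _.
  have x0 : 0 < x by rewrite powR_gt0.
  have y0 : 0 < y by rewrite powR_gt0.
  move=> rs rec; rewrite ler_pdivrMr//.
  have : kappa = kappa * x * x^-1 by rewrite mulfK// gt_eqF.
  move=> ->; apply: (@le_trans _ _ ((rho n - rho n.+1) * x^-1)).
    by rewrite ler_pM2r ?invr_gt0.
  rewrite (mulrC y) -mulrA ler_wpM2l 1?mulrC//.
  by rewrite subr_ge0 dissipative_succ_le.
(* Fast decrease: the increment is at least [(s ^ theta - 1) rho 0 ^ (- beta)],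
   and [s ^ theta - 1 >= 1 - s ^ (- theta)]. *)
have Kk : K <= kappa `^ th by rewrite ge_min lexx orbT.
apply: (@le_trans _ _ (rho 0%N `^ (- be) * (1 - s `^ (- th)))).
  apply: le_trans (ler_wpM2r m0 Kk) _.
  apply: (@le_trans _ _ (kappa `^ th *
      (kappa `^ (- th) * rho 0%N `^ (- be) * (1 - s `^ (- th))))).
    by rewrite ler_pM2l ?powR_gt0// ge_min lexx orbT.
  by rewrite !mulrA powRN mulfV ?mul1r// gt_eqF// powR_gt0.
have r0n : rho 0%N `^ (- be) <= rho n `^ (- be).
  rewrite !powRN lef_pV2 ?posrE ?powR_gt0//.
  by apply: ge0_ler_powR; rewrite ?nnegrE ?(ltW be0)// dissipative_le.
have : s `^ th * rho n `^ (- be) <= rho n.+1 `^ (- be).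
  have e x : 0 < x -> x `^ (- be) = (x `^ (- (be + 1))) `^ th.
    move=> x0; rewrite -powRrM; congr (_ `^ _).
    by rewrite /be /th; field; rewrite !gt_eqF//; lra.
  rewrite (e _ rn0) (e _ r0) -powRM ?powR_ge0 ?(ltW s0)//.
  apply: ge0_ler_powR; rewrite ?nnegrE ?(ltW th0) ?powR_ge0 ?(ltW rs)//.
  by rewrite mulr_ge0 ?powR_ge0// ltW.
have sth1 : 1 <= s `^ th by rewrite -(powRr0 s) ler_powR// ltW.
have := powR_gt0 (- be) rn0; have := powR_gt0 (- be) r00.
have : 1 - s `^ (- th) <= s `^ th - 1.
  rewrite powRN; set x := s `^ th in sth1 *.
  have x0 : 0 < x by apply: lt_le_trans sth1.
  rewrite -subr_ge0.
  have -> : x - 1 - (1 - x^-1) = (x - 1) ^+ 2 / x by field; rewrite gt_eqF.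
  by rewrite divr_ge0 ?sqr_ge0 ?ltW.
move=> h1 h2 h3 h4.
apply: (@le_trans _ _ (rho n `^ (- be) * (s `^ th - 1))); last by lra.
by apply: ler_pM; rewrite ?subr_ge0// ltW.
Qed.

(** The increments add up to [rho n ^ (- (p - 2) / p) >= n delta], the power of
    [rho 0] being dropped as nonnegative. *)
Lemma dissipative_power_rate delta n : 2 < p -> 0 < delta -> (0 < n)%N ->
  (forall k, 0 < rho k.+1 ->
     delta <= rho k.+1 `^ (- ((p - 2) / p)) - rho k `^ (- ((p - 2) / p))) ->
  rho n <= delta^-1 `^ (p / (p - 2)) * n%:R `^ (- (p / (p - 2))).
Proof.
move=> p_gt2 de0 n0 step; set be := (p - 2) / p in step.
have be0 : 0 < be by rewrite divr_gt0//; lra.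
have [rn0|] := ltP 0 (rho n); last first.
  by move=> /le_trans; apply; rewrite mulr_ge0 ?powR_ge0.
have {}step : n%:R * delta <= rho n `^ (- be).
  elim: n n0 rn0 => // n IH _ rn0; have := step _ rn0.
  have [->|n0] := posnP n.
    by rewrite mul1r; have := powR_ge0 (rho 0%N) (- be); lra.
  have := IH n0 (lt_le_trans rn0 (dissipative_succ_le n)).
  by rewrite -natr1; lra.
have nd0 : 0 < n%:R * delta by rewrite mulr_gt0// ltr0n.
have -> : p / (p - 2) = be^-1 by rewrite /be invf_div.
have -> : delta^-1 `^ be^-1 = delta `^ (- be^-1).
  by rewrite -(powR_inv1 (ltW de0)) -powRrM mulN1r.
rewrite -powRM ?(ltW de0)// mulrC powRN.
rewrite -[leLHS]invrK lef_pV2 ?posrE ?invr_gt0 ?powR_gt0//.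
have -> : (rho n)^-1 = (rho n `^ (- be)) `^ be^-1.
  by rewrite -powRrM mulNr mulfV ?gt_eqF// powR_inv1// ltW.
by apply: ge0_ler_powR; rewrite ?nnegrE ?invr_ge0 ?powR_ge0 ?(ltW be0) ?(ltW nd0).
Qed.

End dissipative_sequences.

(** * Finite length in a Banach space *)

Section finite_length.
Context {R : realType} {X : completeNormedModType R}.
Implicit Types y : nat -> X.

(** Absolute convergence of the telescoping series, in a complete space. *)
Lemma bounded_length_cvg y (C : R) :
  (forall N, \sum_(i < N) `|y i.+1 - y i| <= C) -> cvgn y.
Proof.
move=> yC; suff : cvgn (series (telescope y)).
  move=> cv; have -> : y = (fun n => y 0%N + series (telescope y) n).
    by apply/funext => n; exact: eq_sum_telescope.
  by apply: is_cvgD => //; exact: is_cvg_cst.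
apply: normed_cvg; apply: nondecreasing_is_cvgn.
  apply/nondecreasing_seqP => n; rewrite -subr_ge0 seriesSB/=.
  exact: normr_ge0.
exists C => _ [n _ <-]; have := yC n.
by rewrite -(big_mkord xpredT (fun i => `|y i.+1 - y i|)).
Qed.

Lemma bounded_nneseries_lty (d : nat -> R) (C : R) :
  (forall n, 0 <= d n) -> (forall N, \sum_(i < N) d i <= C) ->
  (\sum_(0 <= n <oo) (d n)%:E < +oo)%E.
Proof.
move=> d0 dC; apply: le_lt_trans (ltry C); apply: lime_le.
  by apply: is_cvg_nneseries => n _ _; rewrite lee_fin.
by apply: nearW => N; rewrite sumEFin lee_fin big_mkord.
Qed.

Lemma cvg_dist_le_length y yoo k (C : R) : y @ \oo --> yoo ->
  (forall N, \sum_(i < N) `|y (k + i).+1 - y (k + i)%N| <= C) ->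
  `|y k - yoo| <= C.
Proof.
move=> ycvg yC.
have yk N : `|y k - y (k + N)%N| <= \sum_(i < N) `|y (k + i).+1 - y (k + i)%N|.
  elim: N => [|N IH]; first by rewrite addn0 subrr normr0 big_ord0.
  rewrite big_ord_recr/= addnS.
  rewrite -(subrK (y (k + N)%N) (y k)) -addrA (le_trans (ler_normD _ _))//.
  by rewrite lerD// distrC.
have : (fun n => `|y k - y n|) @ \oo --> `|y k - yoo|.
  by apply: cvg_norm; apply: cvgB => //; exact: cvg_cst.
move=> /cvgr_to_le; apply; near=> n.
have kn : (k <= n)%N by near: n; exists k.
by rewrite -(subnKC kn) (le_trans (yk _)).
Unshelve. all: by end_near. Qed.

End finite_length.

Section finite_length_rates.
Context {R : realType} {X : completeNormedModType R}.
Context {a b p : R} {rho : nat -> R} {y : nat -> X}.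
Context (a0 : 0 < a) (b0 : 0 < b) (p1 : 1 <= p).
Context (H : dissipative a b p rho (fun n => `|y n.+1 - y n|)).

(** The first step is set apart because [dissipative_length] starts at the
    second. *)
Lemma dissipative_total_length N : \sum_(i < N) `|y i.+1 - y i| <=
  `|y 1%N - y 0%N| + (b / a * p * rho 1%N `^ p^-1 + `|y 1%N - y 0%N|).
Proof.
have C0 : 0 <= b / a * p * rho 1%N `^ p^-1 + `|y 1%N - y 0%N|.
  rewrite addr_ge0// !mulr_ge0 ?powR_ge0// ?invr_ge0 ?(ltW a0) ?(ltW b0)//.
  exact: le_trans p1.
case: N => [|N]; first by rewrite big_ord0 addr_ge0.
by rewrite big_ord_recl lerD2l; exact: (dissipative_length a0 b0 p1 H 0).
Qed.

Lemma dissipative_is_cvg : cvgn y.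
Proof. by apply: bounded_length_cvg; exact: dissipative_total_length. Qed.

Lemma dissipative_step_le k : `|y k.+1 - y k| <= a `^ (- 2^-1) * rho k `^ 2^-1.
Proof.
have dec := dissipative_decrease H k.
have r0 := dissipative_ge0 H.
have e : `|y k.+1 - y k| = (`|y k.+1 - y k| ^+ 2) `^ 2^-1.
  by rewrite powR12_sqrt ?sqr_ge0// sqrtr_sqr normr_id.
have -> : a `^ (- 2^-1) = a^-1 `^ 2^-1.
  by rewrite -(powR_inv1 (ltW a0)) -powRrM mulN1r.
rewrite -powRM ?invr_ge0 ?(ltW a0)// e.
apply: ge0_ler_powR; rewrite ?nnegrE ?mulr_ge0 ?invr_ge0 ?(ltW a0)//.
by rewrite mulrC ler_pdivlMr//; have := r0 k.+1; lra.
Qed.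

(** The remaining length from [y k.+1] bounds the distance to the limit; the
    gap at [k.+1] is then weakened to the one at [k], and the step [k] is
    estimated by the decrease condition. *)
Lemma dissipative_dist_le yoo k : y @ \oo --> yoo ->
  `|y k.+1 - yoo| <=
    b / a * p * rho k `^ p^-1 + a `^ (- 2^-1) * rho k `^ 2^-1.
Proof.
move=> ycvg; apply: le_trans (lerD _ (dissipative_step_le k)).
  apply: (cvg_dist_le_length ycvg) => N.
  exact: (dissipative_length a0 b0 p1 H k).
have p0 : 0 < p by apply: lt_le_trans p1.
rewrite ler_wpM2l ?mulr_ge0 ?invr_ge0 ?(ltW a0) ?(ltW b0) ?(ltW p0)//.
apply: ge0_ler_powR; rewrite ?nnegrE ?invr_ge0 ?(ltW p0) ?(dissipative_ge0 H)//.
exact: dissipative_succ_le a0 H _.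
Qed.

Lemma dissipative_stationary yoo n : y @ \oo --> yoo -> rho n = 0 -> y n = yoo.
Proof.
move=> ycvg rn0; have p0 : 0 < p by apply: lt_le_trans p1.
have := dissipative_dist_le n ycvg; have := dissipative_step_le n.
rewrite rn0 !powR0 ?invr_eq0 ?gt_eqF// !mulr0 addr0 !normr_le0 !subr_eq0.
by move=> /eqP <- /eqP.
Qed.

Lemma dissipative_dist_le_sqrt yoo k : y @ \oo --> yoo -> p <= 2 ->
  `|y k.+1 - yoo| <=
  (b / a * p * rho 0%N `^ p^-1 * rho 0%N `^ (- 2^-1) + a `^ (- 2^-1))
    * rho k `^ 2^-1.
Proof.
move=> ycvg p2; apply: le_trans (dissipative_dist_le k ycvg) _.
have p0 : 0 < p by apply: lt_le_trans p1.
rewrite mulrDl lerD2r -!mulrA.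
do 3! rewrite ler_wpM2l ?invr_ge0 ?(ltW a0) ?(ltW b0) ?(ltW p0)//.
rewrite mulrA powR_le_split//; first by rewrite (dissipative_ge0 H) (dissipative_le a0 H).
by rewrite invr_gt0 ltr0n/= lef_pV2 ?posrE.
Qed.

Lemma dissipative_dist_le_root yoo k : y @ \oo --> yoo -> 2 <= p ->
  `|y k.+1 - yoo| <=
  (b / a * p + a `^ (- 2^-1) * rho 0%N `^ 2^-1 * rho 0%N `^ (- p^-1))
    * rho k `^ p^-1.
Proof.
move=> ycvg p2; apply: le_trans (dissipative_dist_le k ycvg) _.
have p0 : 0 < p by apply: lt_le_trans p1.
rewrite mulrDl lerD2l -!mulrA ler_wpM2l ?powR_ge0//.
rewrite mulrA powR_le_split//; first by rewrite (dissipative_ge0 H) (dissipative_le a0 H).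
by rewrite invr_gt0 p0/= lef_pV2 ?posrE.
Qed.

End finite_length_rates.

(** * The explicit constants *)

Section constants.
Context {R : realType} {X : completeNormedModType R}.
Context {a b p : R} {rho : nat -> R} {y : nat -> X} {yoo : X}.
Context (a0 : 0 < a) (b0 : 0 < b) (p1 : 1 <= p).
Context (H : dissipative a b p rho (fun n => `|y n.+1 - y n|)).
Context (ycvg : y @ \oo --> yoo).

(** For [p <= 2] the square root is the dominant power near [0] in
    [dissipative_dist_le], for [p >= 2] it is the [p]-th root; the two
    constants agree at [p = 2]. *)
Lemma dissipative_distance_constant : exists2 C, 0 < C &
  (p <= 2 -> forall k, `|y k.+1 - yoo| <= C * rho k `^ 2^-1) /\
  (2 <= p -> forall k, `|y k.+1 - yoo| <= C * rho k `^ p^-1) /\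
  (0 < rho 0%N ->
    (2 <= p ->
      C = b / a * p + a `^ (- 2^-1) * rho 0%N `^ 2^-1 * rho 0%N `^ (- p^-1)) /\
    (p <= 2 ->
      C = b / a * p * rho 0%N `^ p^-1 * rho 0%N `^ (- 2^-1) + a `^ (- 2^-1))).
Proof.
have p0 : 0 < p by apply: lt_le_trans p1.
have c0 : 0 < b / a * p by rewrite mulr_gt0// divr_gt0.
have a2 : 0 < a `^ (- 2^-1) by rewrite powR_gt0.
have [p2|p2|p2] := ltgtP p 2.
- eexists; last first.
    split.
      by move=> _ k; apply: (dissipative_dist_le_sqrt a0 b0 p1 H k ycvg (ltW p2)).
    by split=> // [//|_]; split.
  by rewrite ltr_wpDl// mulr_ge0 ?powR_ge0// mulr_ge0 ?powR_ge0// ltW.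
- eexists; last first.
    split; first by [].
    split.
      by move=> _ k; apply: (dissipative_dist_le_root a0 b0 p1 H k ycvg (ltW p2)).
    by move=> _; split.
  by rewrite ltr_wpDr// !mulr_ge0 ?powR_ge0.
- have p_le2 : p <= 2 by rewrite p2.
  have bound k := dissipative_dist_le_sqrt a0 b0 p1 H k ycvg p_le2.
  eexists; last first.
    split; first by move=> _; exact: bound.
    split.
      by move=> _ k; have := bound k; rewrite (_ : rho k `^ 2^-1 = rho k `^ p^-1)// p2.
    move=> r0; split=> // _; rewrite p2.
    have -> : rho 0%N `^ (- 2^-1) = (rho 0%N `^ 2^-1)^-1 by rewrite powRN.
    by rewrite -!mulrA mulfV ?mulr1// gt_eqF// powR_gt0.
  by rewrite ltr_wpDl// mulr_ge0 ?powR_ge0// mulr_ge0 ?powR_ge0// ltW.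
Qed.

End constants.

(** A decreasing function and an increasing one: the maximum of their minimum
    is attained where they cross. The crossing point comes from the
    intermediate value theorem on [[1, B]]. *)
Lemma is_maximum_min_crossing (R : realType) (q p A t : R) :
  0 < q -> 0 < p -> 0 < A -> 0 < t ->
  exists m, 0 < m /\
    is_maximum [set Num.min (q / (p * s)) (A * (1 - s `^ (- t)))
                | s in [set s : R | 1 <= s]] m.
Proof.
move=> q0 p0 A0 t0.
set F := fun s : R => q / (p * s); set G := fun s : R => A * (1 - s `^ (- t)).
have F_anti s s' : 0 < s -> s <= s' -> F s' <= F s.
  move=> s0 ss'; rewrite /F ler_pM2l// lef_pV2 ?posrE ?mulr_gt0//.
    by rewrite ler_pM2l.
  exact: lt_le_trans ss'.
have G_homo s s' : 0 < s -> s <= s' -> G s <= G s'.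
  move=> s0 ss'; rewrite /G ler_pM2l// lerD2l lerN2 !powRN.
  rewrite lef_pV2 ?posrE ?powR_gt0//; last exact: lt_le_trans ss'.
  by apply: ge0_ler_powR; rewrite ?nnegrE ?(ltW t0) ?(ltW s0)// (le_trans (ltW s0)).
(* The first bound makes the increasing function at least [A / 2] at [B], the
   second one makes the decreasing function at most [A / 2]. *)
pose B := Num.max (2 `^ t^-1) (2 * q / (p * A)).
have B1 : 1 <= B.
  by rewrite le_max -[X in X <= _](powRr0 2) ler_powR ?invr_ge0 ?(ltW t0)// ler1n.
have B0 : 0 < B by apply: lt_le_trans B1.
have FGB : F B <= G B.
  apply: (@le_trans _ _ (A / 2)).
    rewrite /F ler_pdivrMr ?mulr_gt0//.
    have : 2 * q / (p * A) <= B by rewrite le_max lexx orbT.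
    by rewrite ler_pdivrMr ?mulr_gt0//; lra.
  rewrite /G ler_pM2l//.
  have : B `^ (- t) <= 2^-1.
    rewrite powRN lef_pV2 ?posrE ?powR_gt0//.
    rewrite [leLHS](_ : _ = (2 `^ t^-1) `^ t); last first.
      by rewrite -powRrM mulVf ?powRr1// gt_eqF.
    apply: ge0_ler_powR; rewrite ?nnegrE ?powR_ge0 ?(ltW t0) ?(ltW B0)//.
    by rewrite le_max lexx.
  by lra.
have [s] : exists2 s, s \in `[1, B] & G s - F s = 0.
  apply: (@IVT _ (fun s => G s - F s)) => //.
    apply: derivable_within_continuous => s; rewrite in_itv/= => /andP[s1 _].
    have s0 : 0 < s by apply: lt_le_trans s1.
    apply: derivableB.
      apply: derivableM => //; apply: derivableB => //.
      by apply: derivable_powR; rewrite in_itv/= s0.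
    apply: derivableM => //; apply: derivableV; first by rewrite mulf_neq0// gt_eqF.
    exact: derivableM.
  rewrite ge_min le_max !subr_ge0 !subr_le0 FGB orbT andbT.
  by rewrite [G 1]/G powR1 subrr mulr0 divr_ge0 ?(ltW q0)// mulr1 ltW.
rewrite in_itv/= => /andP[s1 _] /eqP; rewrite subr_eq0 => /eqP GF.
have s0 : 0 < s by apply: lt_le_trans s1.
exists (F s); split; first by rewrite divr_gt0// mulr_gt0.
split; first by exists s => //; rewrite -/(F s) -/(G s) GF minxx.
move=> _ [s' /= s'1 <-]; rewrite -/(F s') -/(G s') ge_min.
have s'0 : 0 < s' by apply: lt_le_trans s'1.
have [ss'|s's] := leP s s'; first by rewrite F_anti.
by rewrite -GF G_homo ?orbT// ltW.
Qed.

Lemma dissipative_power_constant (R : realType) (a b p : R) (rho d : nat -> R) :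
  0 < a -> 0 < b -> 2 < p -> dissipative a b p rho d ->
  exists2 C, 0 < C &
    (forall n, (0 < n)%N ->
      rho n <= C `^ (p / (p - 2)) * n%:R `^ (- (p / (p - 2)))) /\
    (0 < rho 0%N -> exists m : R,
      is_maximum
        [set Num.min ((p - 2) / (p * s))
             ((a / b ^+ 2) `^ ((2 - p) / (2 * p - 2))
              * rho 0%N `^ ((2 - p) / p)
              * (1 - s `^ (- ((p - 2) / (2 * p - 2)))))
        | s in [set s : R | 1 <= s]] m /\
      C^-1 = Num.min (a / b ^+ 2) ((a / b ^+ 2) `^ ((p - 2) / (2 * p - 2))) * m).
Proof.
move=> a0 b0 p2 H; have p1 : 1 <= p by lra.
have p0 : 0 < p by lra.
have k0 : 0 < a / b ^+ 2 by rewrite divr_gt0// exprn_gt0.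
have [r0|r0] := ltP 0 (rho 0%N); last first.
  (* All gaps vanish, so that any positive constant will do. *)
  exists 1 => //; split=> //.
  move=> n _; apply: (@le_trans _ _ 0); last by rewrite mulr_ge0 ?powR_ge0.
  exact: le_trans (dissipative_le a0 H (leq0n n)) r0.
set A := (a / b ^+ 2) `^ ((2 - p) / (2 * p - 2)) * rho 0%N `^ ((2 - p) / p).
have [||||m [m0 hm]] := @is_maximum_min_crossing R (p - 2) p A ((p - 2) / (2 * p - 2)).
- by lra.
- by [].
- by rewrite mulr_gt0 ?powR_gt0.
- by rewrite divr_gt0; lra.
set K := Num.min _ _.
have K0 : 0 < K by rewrite lt_min k0 powR_gt0.
exists (K * m)^-1; first by rewrite invr_gt0 mulr_gt0.
split; last by move=> _; exists m; split=> //; rewrite invrK.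
move=> n n0; apply: (dissipative_power_rate a0 p1 H) => //; first by rewrite mulr_gt0.
move=> k rk0; have [[s /= s1 <-] _] := hm.
exact: (dissipative_power_step a0 b0 p1 H).
Qed.

(** A power rate valid for [n > 0] survives a shift of the index by one: for [n
    > 0] use [n + 1 <= 2 n], and enlarge the constant to cover [rho 0]. *)
Lemma powR_shift_rate (R : realType) (C q : R) (rho : nat -> R) :
  0 < C -> 0 < q -> (forall n, 0 <= rho n) ->
  (forall n, (0 < n)%N -> rho n <= C `^ q * n%:R `^ (- q)) ->
  exists2 C', 0 < C' & forall n, rho n <= C' `^ q * n.+1%:R `^ (- q).
Proof.
move=> C0 q0 rho0 rate; exists (Num.max (2 * C) (rho 0%N `^ q^-1)).
  by rewrite lt_max mulr_gt0.
set C' := Num.max _ _.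
have C'0 : 0 < C' by rewrite lt_max mulr_gt0.
case=> [|n].
  rewrite powR1 mulr1 [leLHS](_ : _ = (rho 0%N `^ q^-1) `^ q); last first.
    by rewrite -powRrM mulVf ?powRr1// gt_eqF.
  apply: ge0_ler_powR; rewrite ?nnegrE ?powR_ge0 ?(ltW q0) ?(ltW C'0)//.
  by rewrite le_max lexx orbT.
apply: le_trans (rate n.+1 isT) _.
have invE (k : nat) : k%:R `^ (- q) = (k%:R^-1 : R) `^ q.
  by rewrite -powR_inv1// -powRrM mulN1r.
rewrite !invE -!powRM ?invr_ge0 ?(ltW C0) ?(ltW C'0)//.
apply: ge0_ler_powR; rewrite ?nnegrE ?mulr_ge0 ?invr_ge0 ?(ltW q0) ?(ltW C0) ?(ltW C'0)//.
rewrite ler_pdivrMr ?ltr0n// mulrAC ler_pdivlMr ?ltr0n// -[n.+2%:R]natr1.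
have : 2 * C <= C' by rewrite le_max lexx.
have : 1 <= n.+1%:R :> R by rewrite ler1n.
nra.
Qed.

(** * Inner products *)

Section inner_product.
Context {R : realType} {X : normedModType R}.
Context {dot : {dot X for idfun}} (hdot : induces_norm dot).
Implicit Types u v w : X.

Lemma dotC u v : dot u v = dot v u.
Proof. by rewrite hermC expr0 mul1r. Qed.

Lemma dotDl u v w : dot (u + v) w = dot u w + dot v w.
Proof. exact: linearDl. Qed.

Lemma dotZl t u v : dot (t *: u) v = t * dot u v.
Proof. exact: linearZl_LR. Qed.

Lemma dotNl u v : dot (- u) v = - dot u v.
Proof. by rewrite -scaleN1r dotZl mulN1r. Qed.

Lemma dotBl u v w : dot (u - v) w = dot u w - dot v w.
Proof. by rewrite dotDl dotNl. Qed.

Lemma dotDr u v w : dot u (v + w) = dot u v + dot u w.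
Proof. by rewrite dotC dotDl !(dotC u). Qed.

Lemma dotZr t u v : dot u (t *: v) = t * dot u v.
Proof. by rewrite dotC dotZl dotC. Qed.

Lemma dotNr u v : dot u (- v) = - dot u v.
Proof. by rewrite dotC dotNl dotC. Qed.

Lemma dotBr u v w : dot u (v - w) = dot u v - dot u w.
Proof. by rewrite dotDr dotNr. Qed.

Lemma normD_sqr u v : `|u + v| ^+ 2 = `|u| ^+ 2 + 2 * dot u v + `|v| ^+ 2.
Proof. by rewrite !hdot dotDl !dotDr (dotC v u); ring. Qed.

(** Cauchy-Schwarz is the triangle inequality, squared, since the norm is the
    given one. *)
Lemma dot_le_norm u v : dot u v <= `|u| * `|v|.
Proof.
have : `|u + v| ^+ 2 <= (`|u| + `|v|) ^+ 2.
  by rewrite ler_sqr ?nnegrE ?addr_ge0// ler_normD.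
by rewrite normD_sqr; nra.
Qed.

End inner_product.

(** * Convex functions with Lipschitz gradient *)

Section smooth_convex.
Context {R : realType} {X : normedModType R}.
Context {dot : {dot X for idfun}} (hdot : induces_norm dot).
Context {h : X -> R^o} {gradh : X -> X} (hgrad : is_gradient dot h gradh).
Implicit Types x y v : X.

Lemma gradient_derive x v : derivable h x v /\ 'D_v h x = dot (gradh x) v.
Proof.
have [dh hd] := hgrad x; split; first exact: diff_derivable.
by rewrite deriveE// hd.
Qed.

Lemma gradient_derive_line x v (t : R) :
  is_derive t 1 (fun s : R => h (s *: v + x)) (dot (gradh (t *: v + x)) v).
Proof.
have [dh hd] := gradient_derive (t *: v + x) v.
(* The difference quotient at [t] along the line is the one of [h] at the point
   [t *: v + x] in the direction [v]. *)
have e : (fun s : R => s^-1 *: (((fun s : R => h (s *: v + x)) \o shift t) (s *: 1)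
      - h (t *: v + x))) =
    (fun s : R => s^-1 *: ((h \o shift (t *: v + x)) (s *: v) - h (t *: v + x))).
  apply/funext => s /=; congr (_ *: (h _ - _)).
  by rewrite [s *: 1]mulr1 scalerDl addrA.
by split; rewrite /derivable/derive e.
Qed.

Context (hconv : convex_function setT h).

Lemma convex_functionTP (t : R) x y : 0 < t < 1 ->
  h (t *: x + (1 - t) *: y) <= t * h x + (1 - t) * h y.
Proof.
move=> /andP[t0 t1].
have := hconv (Itv01 (ltW t0) (ltW t1)) (in_setT x) (in_setT y).
by rewrite convRE.
Qed.

(** The chords from [x] towards [y] have slope at most [h y - h x], hence so
    does their limit. *)
Lemma convex_gradient_le x y : h x + dot (gradh x) (y - x) <= h y.
Proof.
have [dh <-] := gradient_derive x (y - x).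
rewrite addrC -lerBrDr.
have /cvg_dnbhs_at_right : (fun t : R => t^-1 *: ((h \o shift x) (t *: (y - x)) - h x)) @ 0^'
   --> 'D_(y - x) h x by exact: dh.
move=> /cvgr_to_le; apply; near=> t.
have t0 : 0 < t by near: t; exact: nbhs_right_gt.
have t1 : t < 1 by near: t; exact: nbhs_right_lt.
rewrite /= [_ *: _]mulrC ler_pdivrMr//.
have -> : t *: (y - x) + x = t *: y + (1 - t) *: x.
  by rewrite scalerBr scalerBl scale1r addrAC addrA.
have t01 : 0 < t < 1 by rewrite t0.
have := convex_functionTP y x t01; lra.
Unshelve. all: by end_near. Qed.

Context {L : R} (L0 : 0 < L) (hlip : L.-lipschitz gradh).

Lemma lipschitz_norm x y : `|gradh x - gradh y| <= L * `|x - y|.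
Proof. by apply: (hlip (x := (x, y))). Qed.

(** Along the segment from [x] to [y], the difference between [h] and the
    quadratic upper bound has a nonpositive derivative by the Lipschitz
    condition. *)
Lemma descent_lemma x y :
  h y <= h x + dot (gradh x) (y - x) + L / 2 * `|y - x| ^+ 2.
Proof.
set v := y - x.
pose F (t : R) := h (t *: v + x) - (dot (gradh x) v * t + L / 2 * `|v| ^+ 2 * t ^+ 2).
pose dF (t : R) := dot (gradh (t *: v + x)) v
    - (dot (gradh x) v * 1 + L / 2 * `|v| ^+ 2 * (2 * t)).
have FdF (t : R) : is_derive t 1 F (dF t).
  apply: is_deriveB; first exact: gradient_derive_line.
  have -> : (fun s : R => dot (gradh x) v * s + L / 2 * `|v| ^+ 2 * s ^+ 2) =
      dot (gradh x) v \*: (id : R -> R^o) + (L / 2 * `|v| ^+ 2) \*: ((id : R -> R^o) ^+ 2).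
    by apply/funext.
  apply: is_deriveD; apply: is_deriveZ.
  apply: (is_derive_eq (is_deriveX 2 (is_derive_id _ _))).
  by rewrite /= expr1 [_ *: _]mulr1.
have [t] : exists2 t, t \in `]0, 1[%R & F 1 - F 0 = dF t * (1 - 0).
  apply: MVT => //.
  by apply: derivable_within_continuous => t _; have [] := FdF t.
rewrite in_itv/= => /andP[t0 t1].
have : dF t <= 0.
  rewrite /dF.
  have := dot_le_norm hdot (gradh (t *: v + x) - gradh x) v.
  have := lipschitz_norm (t *: v + x) x.
  rewrite addrK normrZ (gtr0_norm t0) dotBl.
  move=> h1 h2.
  have := ler_wpM2r (normr_ge0 v) h1; nra.
rewrite /F scale1r scale0r add0r /v subrK; lra.
Qed.

(** Baillon-Haddad. The intermediate inequality improves the gradient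
    inequality from [a] to [b]: test it at [b] moved by a gradient step of
    length [1 / L] for the convex function [h - dot (gradh a)], which is
    minimal at [a]. Add it to its mirror image. *)
Lemma cocoercive x y :
  `|gradh x - gradh y| ^+ 2 <= L * dot (gradh x - gradh y) (x - y).
Proof.
have key a b : h a + dot (gradh a) (b - a) +
    (2 * L)^-1 * `|gradh b - gradh a| ^+ 2 <= h b.
  set w := gradh b - gradh a; set z := b - L^-1 *: w.
  have h1 := convex_gradient_le a z.
  have h2 := descent_lemma b z.
  have zb : z - b = - (L^-1 *: w) by rewrite /z addrC addKr.
  have za : z - a = (b - a) - L^-1 *: w by rewrite /z addrAC.
  have ww : `|w| ^+ 2 = dot (gradh b) w - dot (gradh a) w by rewrite hdot -dotBl.
  move: h1 h2; rewrite zb za dotBr dotNr !dotZr normrN normrZ gtr0_norm ?invr_gt0//.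
  rewrite exprMn => h1 h2.
  have := le_trans h1 h2.
  set A := h a; set B := h b; set N := `|w|^+2 in ww *.
  have -> : L / 2 * (L^-1 ^+ 2 * N) = L^-1 * (N / 2) by field; rewrite gt_eqF.
  have -> : (2 * L)^-1 * N = L^-1 * (N / 2) by field; rewrite gt_eqF.
  have : L^-1 * N = L^-1 * dot (gradh b) w - L^-1 * dot (gradh a) w by rewrite ww mulrBr.
  have -> : L^-1 * N = L^-1 * (N / 2) + L^-1 * (N / 2) by field; rewrite gt_eqF.
  lra.
have := key x y; have := key y x.
rewrite -(distrC (gradh x)) -(opprB x y) dotNr dotBl.
set N := _ ^+ 2.
have : (2 * L)^-1 * N * (2 * L) = N by field; rewrite gt_eqF.
set K := _ * N => e h1 h2.
have : 2 * K <= dot (gradh x) (x - y) - dot (gradh y) (x - y) by lra.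
by move=> /(ler_wpM2l (ltW L0)); lra.
Qed.

End smooth_convex.

(** * One forward-backward step *)

Section forward_backward.
Context {R : realType} {X : normedModType R}.
Context {dot : {dot X for idfun}} (hdot : induces_norm dot).

(** Fermat's rule. Compare [y] with [t u + (1 - t) y]: by convexity of [g] the
    first-order terms in [t] give the subgradient inequality up to [t] times a
    constant, and [t] tends to [0]. *)
Lemma prox_subdiff (g : X -> \bar R) (lambda : R) (z y : X) :
  Gamma0 g -> 0 < lambda -> prox lambda g z y ->
  (g y < +oo)%E /\ subdiff dot g y (lambda^-1 *: (z - y)).
Proof.
move=> [[gNy [u0 gu0]] gconv _] l0 ymin.
have gyfin : (g y < +oo)%E.
  have := ymin u0; have := gNy y.
  case: (g y) => [r _ _|//|//]; first exact: ltry.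
  by move: gu0; rewrite /edom/=; case: (g u0) => //= r; rewrite -EFinD leye_eq.
split=> // u; have := gNy u; case Egu : (g u) => [gu|//|//] _; last exact: leey.
have := gNy y; move: gyfin; case Egy : (g y) => [gy|//|//] _ _.
rewrite -EFinD lee_fin dotZl.
set D := dot (z - y) (u - y).
have key (t : R) : 0 < t < 1 ->
    gy - gu <= - (lambda^-1 * D) + t * ((2 * lambda)^-1 * `|u - y| ^+ 2).
  move=> t01; have t0 : 0 < t by case/andP: t01.
  have := gconv t u y t01; rewrite Egu Egy -!EFinM -EFinD => gt_le.
  have := ymin (t *: u + (1 - t) *: y); rewrite Egy.
  have -> : t *: u + (1 - t) *: y - z = (y - z) + t *: (u - y).
    rewrite scalerBl scale1r scalerBr addrCA -!addrA; congr (_ + _).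
    by rewrite [RHS]addrC -addrA addrC.
  move=> /le_trans /(_ (leeD2r _ gt_le)); rewrite -!EFinD lee_fin.
  rewrite (normD_sqr hdot (y - z)) dotZr normrZ exprMn (gtr0_norm t0).
  have -> : dot (y - z) (u - y) = - D by rewrite -opprB dotNl.
  have -> : lambda^-1 = 2 * (2 * lambda)^-1 by field; rewrite gt_eqF.
  set k := (2 * lambda)^-1; set N := `|u - y| ^+ 2; set M := `|y - z| ^+ 2 => hle.
  rewrite -(ler_pM2l t0); lra.
set K := _ * `|u - y| ^+ 2 in key.
have K0 : 0 <= K by rewrite mulr_ge0 ?sqr_ge0// invr_ge0 mulr_ge0 ?ltW.
suff : gy - gu <= - (lambda^-1 * D) by lra.
apply/ler_addgt0Pr => e e0.
have [t t01 tK] : exists2 t : R, 0 < t < 1 & t * K <= e.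
  (* This value is below [1], and its product with [K] below [e]. *)
  exists (e / (e + K + 1)).
    by rewrite divr_gt0 ?ltr_pdivrMr ?mul1r//=; lra.
  by rewrite mulrAC ler_pdivrMr; nra.
by have := key t t01; lra.
Qed.

Context {g : X -> \bar R} (hg : Gamma0 g).
Context {h : X -> R^o} (hconv : convex_function setT h).
Context {gradh : X -> X} (hgrad : is_gradient dot h gradh).
Context {L : R} (L0 : 0 < L) (hlip : L.-lipschitz gradh).
Context {f : X -> \bar R} (hf : forall u, f u = (g u + (h u)%:E)%E).
Context {lambda : R} (hlambda : 0 < lambda < 2 * L^-1).
Context {x y : X} (hprox : prox lambda g (x - lambda *: gradh x) y).

Let l0 : 0 < lambda. Proof. by case/andP: hlambda. Qed.

Let v := lambda^-1 *: (x - y) - (gradh x - gradh y).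

Let backward_subgradient : (g y < +oo)%E /\
  subdiff dot g y (lambda^-1 *: (x - y) - gradh x).
Proof.
have [gy gsub] := prox_subdiff hg l0 hprox; split => //.
suff <- : lambda^-1 *: (x - lambda *: gradh x - y) =
  lambda^-1 *: (x - y) - gradh x by [].
by rewrite addrAC scalerBr scalerA mulVf ?scale1r// gt_eqF.
Qed.

Lemma forward_backward_edom : (f y < +oo)%E.
Proof.
have [gy _] := backward_subgradient.
by rewrite hf lte_add_pinfty// ltry.
Qed.

(** The backward step yields a subgradient of [g] at [y] that involves the
    gradient of [h] at the old point; adding the gradient of [h] at the new
    point gives a subgradient of the sum. *)
Lemma forward_backward_subdiff : subdiff dot f y v.
Proof.
move=> u; have [_ gsub] := backward_subgradient.
have hle := convex_gradient_le hgrad hconv y u.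
have -> : v = (lambda^-1 *: (x - y) - gradh x) + gradh y.
  by rewrite /v opprB addrA addrAC.
rewrite !hf dotDl EFinD addeACA.
by apply: leeD; [exact: gsub|rewrite -EFinD lee_fin].
Qed.

(** Expanding the square, this says that [lambda |w| ^ 2 <= 2 dot w (x - y)],
    with [w] the difference of the gradients: cocoercivity and [lambda L <= 2].
    *)
Lemma forward_backward_subgradient_norm : `|v| <= lambda^-1 * `|y - x|.
Proof.
rewrite -ler_sqr ?nnegrE ?mulr_ge0 ?invr_ge0 ?(ltW l0)//.
rewrite /v (normD_sqr hdot) normrN dotNr dotZl normrZ gtr0_norm ?invr_gt0//.
rewrite (distrC y) -addrA gerDl.
have := cocoercive hdot hgrad hconv L0 hlip x y.
rewrite (dotC _ (x - y)); set N := _ ^+ 2; set D := dot _ _ => co.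
have N0 : 0 <= N by rewrite sqr_ge0.
have lL : lambda * L < 2 by case/andP: hlambda => _; rewrite ltr_pdivlMr.
have : lambda * N <= 2 * D.
  have D0 : 0 <= D by rewrite -(pmulr_rge0 _ L0) (le_trans N0).
  by have := ler_wpM2l (ltW l0) co; nra.
move=> hle.
rewrite -(ler_pM2l l0) mulr0.
have -> : lambda * (2 * - (lambda^-1 * D) + N) = lambda * N - 2 * D.
  by field; rewrite gt_eqF.
by rewrite subr_le0.
Qed.

(** The subgradient inequality of the backward step, tested at the old point
    [x], plus the descent lemma from [x] to [y]. *)
Lemma forward_backward_descent :
  (f y + ((2 - lambda * L) / (2 * lambda) * `|y - x| ^+ 2)%:E <= f x)%E.
Proof.
have [_ /(_ x) gsub] := backward_subgradient.
have hle := descent_lemma hdot hgrad hlip x y.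
rewrite !hf.
have hreal : h y + (2 - lambda * L) / (2 * lambda) * `|y - x| ^+ 2 <=
   dot (lambda^-1 *: (x - y) - gradh x) (x - y) + h x.
  rewrite dotBl dotZl -hdot (distrC x).
  have -> : (2 - lambda * L) / (2 * lambda) * `|y - x| ^+ 2 =
     lambda^-1 * `|y - x| ^+ 2 - L / 2 * `|y - x| ^+ 2 by field; rewrite gt_eqF.
  by move: hle; rewrite -(opprB x y) dotNr normrN; lra.
rewrite -addeA -EFinD.
apply: (@le_trans _ _ (g y + (dot (lambda^-1 *: (x - y) - gradh x) (x - y) + h x)%:E)%E).
  by rewrite leeD2l// lee_fin.
by rewrite EFinD addeA leeD2r.
Qed.

End forward_backward.

(** * Forward-backward sequences *)

Lemma Gamma0_einf_fin_num (R : realType) (X : normedModType R)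
    (g f : X -> \bar R) (h : X -> R) :
  Gamma0 g -> (forall u, f u = (g u + (h u)%:E)%E) -> bounded_below f ->
  einf f \is a fin_num.
Proof.
move=> [[_ [u gu]] _ _] hf [m fm]; apply: fin_real; apply/andP; split.
  by apply: lt_le_trans (ltNyr m) _; apply/ereal_infP => _ [v _ <-].
apply: le_lt_trans (_ : f u < +oo)%E; first by apply: ereal_inf_lbound; exists u.
by rewrite hf lte_add_pinfty// ltry.
Qed.

Section forward_backward_sequence.
Context {R : realType} {X : normedModType R}.
Context {dot : {dot X for idfun}} (hdot : induces_norm dot).
Context {g : X -> \bar R} (hg : Gamma0 g).
Context {h : X -> R^o} (hconv : convex_function setT h).
Context {gradh : X -> X} (hgrad : is_gradient dot h gradh).
Context {L : R} (L0 : 0 < L) (hlip : L.-lipschitz gradh).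
Context {f : X -> \bar R} (hf : forall u, f u = (g u + (h u)%:E)%E).
Context {M : R} (hM : einf f = M%:E).
Context {lambda : R} (hlambda : 0 < lambda < 2 * L^-1).
Context {x : nat -> X}.
Context (hx : forall n, prox lambda g (x n - lambda *: gradh (x n)) (x n.+1)).

Let f_ge u : (M%:E <= f u)%E.
Proof. by rewrite -hM; apply: ereal_inf_lbound; exists u. Qed.

(** A proximal point lies in the domain of [g], wherever the step starts. *)
Lemma forward_backward_fin_num n : (0 < n)%N -> f (x n) \is a fin_num.
Proof.
case: n => // n _; apply: fin_real.
rewrite (lt_le_trans (ltNyr M) (f_ge _))/=.
exact: (forward_backward_edom hdot hg hf hlambda (hx n)).
Qed.

(** A positive gap at the end of the step means that the new point is in the
    domain of [f] but is not a minimizer, so that the Lojasiewicz inequality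
    applies to it. *)
Lemma forward_backward_dissipative (Omega : set X) (p c : R) :
  (forall n, Omega (x n)) -> lojasiewicz dot f p Omega c ->
  f (x 0%N) \is a fin_num ->
  dissipative ((2 - lambda * L) / (2 * lambda)) (c / lambda) p
    (fun n => fine (f (x n)) - M) (fun n => `|x n.+1 - x n|).
Proof.
move=> hOmega [c0 hloj] f0fin; have l0 : 0 < lambda by case/andP: hlambda.
have fE n : f (x n) = (fine (f (x n)))%:E.
  by rewrite fineK//; case: n => // n; exact: forward_backward_fin_num.
split=> [n|n|n|n rn0]; [|exact: normr_ge0| |].
- by rewrite subr_ge0 -lee_fin -fE f_ge.
- have := forward_backward_descent hdot hg hgrad hlip hf hlambda (hx n).
  by rewrite (fE n) (fE n.+1) -EFinD lee_fin; lra.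
have xn_star : (Omega `&` dom_star f) (x n.+1).
  split; first exact: hOmega.
  split; first by rewrite /edom/= fE ltry.
  move=> /= xmin; move: rn0; rewrite subr_gt0 -lte_fin -fE ltNge => /negP; apply.
  by rewrite -hM; apply/ereal_infP => _ [u _ <-]; exact: xmin.
have := hloj _ xn_star; rewrite hM (fE n.+1) -EFinB poweR_EFin.
have vsub := forward_backward_subdiff hdot hg hconv hgrad hf hlambda (hx n).
have vnorm := forward_backward_subgradient_norm hdot hconv hgrad L0 hlip
  hlambda (x := x n) (y := x n.+1).
set v := _ - _ in vsub vnorm.
have : (subdiff_norm dot f (x n.+1) <= (`|v|)%:E)%E.
  by apply: ereal_inf_lbound; exists v.
move=> /(lee_wpmul2l (ltW c0 : (0 <= c%:E)%E)) vle /le_trans /(_ vle).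
rewrite -EFinM lee_fin => /le_trans; apply.
by rewrite -mulrA ler_pM2l.
Qed.

(** [f (x n)] tends to [inf f] and [h] is continuous, so [g (x n)] tends to
    [inf f - h xoo]; lower semicontinuity of [g] carries this bound to [xoo].
    *)
Lemma forward_backward_cvg_argmin xoo :
  x @ \oo --> xoo -> (fun n => fine (f (x n)) - M) @ \oo --> (0 : R) ->
  argmin f xoo.
Proof.
move=> xcvg rcvg.
suff fM : (f xoo <= M%:E)%E by move=> u; exact: le_trans (f_ge u).
have [[gNy _] _ glsc] := hg.
have hcont : h (x n) @[n --> \oo] --> h xoo.
  apply: continuous_cvg => //; apply: differentiable_continuous.
  by have [] := hgrad xoo.
rewrite leNgt; apply/negP; rewrite hf => Mf.
have [q Mq qg] : exists2 q : R, M - h xoo < q & (q%:E < g xoo)%E.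
  move: Mf (gNy xoo); case: (g xoo) => [r|_ _|//].
    rewrite -EFinD lte_fin => Mr _; exists ((M - h xoo + r) / 2).
      by lra.
    by rewrite lte_fin; lra.
  by exists (M - h xoo + 1); rewrite ?ltry//; lra.
have [V Vx Vq] := glsc _ _ qg.
have gcvg : (fun n => fine (f (x n)) - M + (M - h (x n))) @ \oo --> 0 + (M - h xoo).
  by apply: cvgD => //; apply: cvgB => //; exact: cvg_cst.
have qM : 0 + (M - h xoo) < q by rewrite add0r.
near \oo => n.
have /Vq : V (x n) by near: n; exact: xcvg.
apply/negP; rewrite -leNgt.
have : fine (f (x n)) - M + (M - h (x n)) < q by near: n; exact: (cvgr_lt _ gcvg).
rewrite addrA subrK.
have : f (x n) \is a fin_num by apply: forward_backward_fin_num; near: n; exists 1%N.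
rewrite hf; case: (g (x n)) => [r|//|//] _ /=.
by rewrite lee_fin addrK => /ltW.
Unshelve. all: by end_near. Qed.

End forward_backward_sequence.

(** * Convergence and rates *)

Theorem theorem4p1 (R : realType) (X : completeNormedModType R)
  (dot : {dot X for idfun}) (hdot : induces_norm dot)
  (g : X -> \bar R) (hg : Gamma0 g)
  (h : X -> R^o) (hconv : convex_function setT h)
  (gradh : X -> X) (hgrad : is_gradient dot h gradh)
  (L : R) (hL : 0 < L) (hlip : L.-lipschitz gradh)
  (f : X -> \bar R) (hf : forall u, f u = (g u + (h u)%:E)%E)
  (hfb : bounded_below f)
  (lambda : R) (hlambda : 0 < lambda < 2 * L^-1)
  (x : nat -> X)
  (hx : forall n, prox lambda g (x n - lambda *: gradh (x n)) (x n.+1))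
  (Omega : set X) (hOmega : forall n, Omega (x n))
  (p : R) (hp : 1 <= p) (c : R) (hloj : lojasiewicz dot f p Omega c) :
  let r := fun n => (f (x n) - einf f)%E in
  let kappa := lambda * (2 - lambda * L) * (2 * c ^+ 2)^-1 in
  (\sum_(0 <= n <oo) (`|x n.+1 - x n|)%:E < +oo)%E /\
  argmin f !=set0 /\
  exists xoo : X,
    argmin f xoo /\
    x @ \oo --> xoo /\
    exists Cp Cp' : R,
      0 < Cp /\ 0 < Cp' /\
      (* (i) *)
      (p = 1 -> forall n : nat,
         (r 0%N * (kappa^-1)%:E <= n%:R%:E)%E -> x n = xoo) /\
      (* (ii) *)
      (1 < p < 2 -> forall n : nat,
         (r n.+1 <= (r n * (kappa^-1)%:E) `^ (p / (2 * (p - 1))))%E /\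
         ((`|x n.+1 - xoo|)%:E <= Cp%:E * r n `^ 2^-1)%E) /\
      (* (iii) *)
      (p = 2 -> forall n : nat,
         (r n.+1 <= ((1 + kappa)^-1)%:E * r n)%E /\
         ((`|x n.+1 - xoo|)%:E <=
            Cp%:E * r 0%N `^ 2^-1 * ((1 + kappa) `^ (- (n%:R / 2)))%:E)%E) /\
      (* (iv) *)
      (2 < p -> forall n : nat,
         (r n <= (Cp' `^ (p / (p - 2)))%:E *
                   eneg_pow n%:R (p / (p - 2)))%E /\
         ((`|x n.+1 - xoo|)%:E <=
            (Cp * Cp' `^ (1 / (p - 2)))%:E *
              eneg_pow n%:R (1 / (p - 2)))%E) /\
      (* explicit constants *)
      ((0 < r 0%N < +oo)%E ->
         let r0 := fine (r 0%N) in
         (2 <= p ->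
            Cp = 2 * p * c * (2 - lambda * L)^-1
                 + (2 * lambda * r0) `^ 2^-1 * (2 - lambda * L) `^ (- 2^-1)
                   * r0 `^ (- p^-1)) /\
         (p <= 2 ->
            Cp = 2 * p * c * r0 `^ p^-1 * (2 - lambda * L)^-1
                   * r0 `^ (- 2^-1)
                 + (2 * lambda) `^ 2^-1 * (2 - lambda * L) `^ (- 2^-1)) /\
         (2 < p ->
            exists m : R,
              is_maximum
                [set Num.min ((p - 2) / (p * s))
                     (kappa `^ ((2 - p) / (2 * p - 2))
                      * r0 `^ ((2 - p) / p)
                      * (1 - s `^ (- ((p - 2) / (2 * p - 2)))))
                | s in [set s : R | 1 <= s]] m /\
              Cp'^-1 =
                Num.min kappa (kappa `^ ((p - 2) / (2 * p - 2))) * m)).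
Proof.
move=> r kappa.
have [c0 _] := hloj.
have l0 : 0 < lambda by case/andP: hlambda.
have lL : 0 < 2 - lambda * L.
  by case/andP: hlambda => _; rewrite ltr_pdivlMr// subr_gt0.
have p0 : 0 < p by apply: lt_le_trans hp.
have [M hM] : exists M : R, einf f = M%:E.
  by exists (fine (einf f)); rewrite fineK// (Gamma0_einf_fin_num hg hf hfb).
pose a := (2 - lambda * L) / (2 * lambda); pose b := c / lambda.
have a0 : 0 < a by rewrite divr_gt0 ?mulr_gt0.
have b0 : 0 < b by rewrite divr_gt0.
have kappaE : a / b ^+ 2 = kappa.
  by rewrite /a /b /kappa; field; rewrite !gt_eqF.
have kappa0 : 0 < kappa by rewrite -kappaE divr_gt0// exprn_gt0.
have baE : b / a * p = 2 * p * c * (2 - lambda * L)^-1.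
  by rewrite /a /b; field; rewrite !gt_eqF.
have aE : a `^ (- 2^-1) = (2 * lambda) `^ 2^-1 * (2 - lambda * L) `^ (- 2^-1).
  have ie (t : R) : 0 < t -> t^-1 `^ 2^-1 = t `^ (- 2^-1).
    by move=> t0; rewrite -(powR_inv1 (ltW t0)) -powRrM mulN1r.
  have i2 : 0 <= (2 - lambda * L)^-1 by rewrite invr_ge0 ltW.
  have l2 : 0 <= 2 * lambda by rewrite mulr_ge0// ltW.
  by rewrite -(ie _ a0) -(ie _ lL) /a invf_div (powRM _ l2 i2).
pose rho n := fine (f (x n)) - M.
have fin n : (0 < n)%N -> f (x n) \is a fin_num.
  exact: (forward_backward_fin_num hdot hg hf hM hlambda hx).
have rE n : f (x n) \is a fin_num -> r n = (rho n)%:E.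
  by move=> fn; rewrite /r hM -{1}(fineK fn) -EFinB.
have diss k : f (x k) \is a fin_num ->
    dissipative a b p (fun n => rho (k + n)%N)
      (fun n => `|x (k + n.+1)%N - x (k + n)%N|).
  move=> fk; have hxk n : prox lambda g
      (x (k + n)%N - lambda *: gradh (x (k + n)%N)) (x (k + n.+1)%N).
    by rewrite addnS; exact: hx.
  apply: (forward_backward_dissipative hdot hg hconv hgrad hL hlip hf hM
    hlambda hxk (fun n => hOmega _) hloj).
  by rewrite addn0.
(* From index [1] on the gaps are finite, even if [x 0] is outside the domain.
   *)
have diss1 := diss 1%N (fin 1%N isT).
have [xoo xcvg1] : exists xoo : X, (fun n => x n.+1) @ \oo --> xoo.
  exact/cvg_ex/(dissipative_is_cvg (y := fun n => x n.+1) a0 b0 hp diss1).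
have xcvg : x @ \oo --> xoo by rewrite -cvg_shiftS.
have xmin : argmin f xoo.
  apply: (forward_backward_cvg_argmin hdot hg hgrad hf hM hlambda hx xcvg).
  rewrite -cvg_shiftS; exact: (dissipative_cvg a0 b0 hp diss1).
split.
  apply: (bounded_nneseries_lty (C := `|x 1%N - x 0%N| + (`|x 2%N - x 1%N| +
    (b / a * p * rho 2%N `^ p^-1 + `|x 2%N - x 1%N|)))) => //.
  have C0 := dissipative_total_length (y := fun n => x n.+1) a0 b0 hp diss1.
  case=> [|N]; last by rewrite big_ord_recl lerD2l; exact: C0.
  by rewrite big_ord0 addr_ge0//; apply: le_trans (C0 0%N); rewrite big_ord0.
split; first by exists xoo.
exists xoo; split=> //; split=> //.
(* The constants, with real gaps. They are the explicit ones when [f (x 0)] is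
   finite; otherwise they come from the shifted sequence. *)
have [Cp [Cp' [Cp0 [Cp'0 [dist_sqrt [dist_root [rate expl]]]]]]] :
  exists Cp Cp', 0 < Cp /\ 0 < Cp' /\
    (p <= 2 -> forall n, f (x n) \is a fin_num ->
      `|x n.+1 - xoo| <= Cp * rho n `^ 2^-1) /\
    (2 <= p -> forall n, f (x n) \is a fin_num ->
      `|x n.+1 - xoo| <= Cp * rho n `^ p^-1) /\
    (2 < p -> forall n, (0 < n)%N ->
      rho n <= Cp' `^ (p / (p - 2)) * n%:R `^ (- (p / (p - 2)))) /\
    (f (x 0%N) \is a fin_num -> 0 < rho 0%N ->
      (2 <= p -> Cp = b / a * p
         + a `^ (- 2^-1) * rho 0%N `^ 2^-1 * rho 0%N `^ (- p^-1)) /\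
      (p <= 2 -> Cp = b / a * p * rho 0%N `^ p^-1 * rho 0%N `^ (- 2^-1)
         + a `^ (- 2^-1)) /\
      (2 < p -> exists m : R, is_maximum
        [set Num.min ((p - 2) / (p * s))
             (kappa `^ ((2 - p) / (2 * p - 2)) * rho 0%N `^ ((2 - p) / p)
              * (1 - s `^ (- ((p - 2) / (2 * p - 2)))))
        | s in [set s : R | 1 <= s]] m /\
        Cp'^-1 = Num.min kappa (kappa `^ ((p - 2) / (2 * p - 2))) * m)).
  case f0 : (f (x 0%N) \is a fin_num).
    have H0 := diss 0%N f0.
    have [Cp Cp0 [dsq [drt dex]]] :=
      dissipative_distance_constant (y := x) a0 b0 hp H0 xcvg.
    have [Cp' Cp'0 [rt ex]] : exists2 C, 0 < C &
        (2 < p -> forall n, (0 < n)%N ->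
          rho n <= C `^ (p / (p - 2)) * n%:R `^ (- (p / (p - 2)))) /\
        (2 < p -> 0 < rho 0%N -> exists m : R, is_maximum
          [set Num.min ((p - 2) / (p * s))
               (kappa `^ ((2 - p) / (2 * p - 2)) * rho 0%N `^ ((2 - p) / p)
                * (1 - s `^ (- ((p - 2) / (2 * p - 2)))))
          | s in [set s : R | 1 <= s]] m /\
          C^-1 = Num.min kappa (kappa `^ ((p - 2) / (2 * p - 2))) * m).
      (* The second constant only enters for [2 < p]: any default will do
         below. *)
      have [p2|p2] := ltP 2 p; last by exists 1.
      have [C C0 [rt ex]] := dissipative_power_constant a0 b0 p2 H0.
      by rewrite kappaE in ex; exists C.
    exists Cp, Cp'; do 2! split=> //.
    split; first by move=> p2 n _; exact: dsq.
    split; first by move=> p2 n _; exact: drt.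
    split=> // _ r0; have [e1 e2] := dex r0.
    by split=> //; split=> // p2; exact: ex.
  have [Cp Cp0 [dsq [drt _]]] :=
    dissipative_distance_constant (y := fun n => x n.+1) a0 b0 hp diss1 xcvg1.
  have [Cp' Cp'0 rt] : exists2 C, 0 < C & (2 < p -> forall n,
      rho n.+1 <= C `^ (p / (p - 2)) * n.+1%:R `^ (- (p / (p - 2)))).
    have [p2|p2] := ltP 2 p; last by exists 1.
    have [C C0 [rt _]] := dissipative_power_constant a0 b0 p2 diss1.
    have q0 : 0 < p / (p - 2) by rewrite divr_gt0// subr_gt0.
    have [C' C'0 rt'] := powR_shift_rate C0 q0 (dissipative_ge0 diss1) rt.
    by exists C'.
  exists Cp, Cp'; do 2! split=> //.
  split; first by move=> p2 [|n]; [rewrite f0|move=> _; exact: dsq].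
  split; first by move=> p2 [|n]; [rewrite f0|move=> _; exact: drt].
  by split=> // p2 [//|n] _; exact: rt.
exists Cp, Cp'; do 2! split=> //.
have rho0 n : f (x n) \is a fin_num -> 0 <= rho n.
  by move=> fn; have := dissipative_ge0 (diss n fn) 0; rewrite /= addn0.
have rdich n : r n = +oo%E \/ f (x n) \is a fin_num.
  have : (M%:E <= f (x n))%E by rewrite -hM; apply: ereal_inf_lbound; exists (x n).
  by rewrite /r hM; case: (f (x n)) => [s|_|//]; [right|left].
split.
  move=> p_eq1 n hn.
  case: (rdich 0%N) => [r0|f0].
    by move: hn; rewrite r0 gt0_mulye ?lte_fin ?invr_gt0// leye_eq.
  rewrite rE// in hn; rewrite -EFinM lee_fin in hn.
  have H0 := diss 0%N f0.
  apply: (dissipative_stationary (y := x) a0 b0 hp H0 xcvg).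
  by apply: (dissipative_finite a0 b0 H0 p_eq1); rewrite kappaE.
split.
  move=> /andP[p_gt1 p_lt2] n.
  have q0 : 0 < p / (2 * (p - 1)) by rewrite divr_gt0// mulr_gt0// subr_gt0.
  case: (rdich n) => [->|fn].
    rewrite gt0_mulye ?lte_fin ?invr_gt0// !poweRyr ?gt_eqF//.
    by rewrite gt0_muley ?lte_fin// !leey.
  split.
    rewrite (rE n fn) (rE n.+1 (fin n.+1 isT)) -EFinM poweR_EFin lee_fin.
    have := dissipative_superlinear a0 b0 hp (diss n fn) 0 p_gt1.
    by rewrite addn0 addn1 kappaE.
  rewrite rE// poweR_EFin -EFinM lee_fin.
  exact: dist_sqrt (ltW p_lt2) _ fn.
split.
  move=> p_eq2 n; split.
    case: (rdich n) => [->|fn].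
      by rewrite gt0_muley ?lte_fin ?invr_gt0 ?addr_gt0// leey.
    rewrite (rE n fn) (rE n.+1 (fin n.+1 isT)) -EFinM lee_fin.
    have := dissipative_linear a0 b0 (diss n fn) 0 p_eq2.
    by rewrite addn0 addn1 kappaE.
  case: (rdich 0%N) => [->|f0].
    rewrite poweRyr ?gt_eqF// gt0_muley ?lte_fin// gt0_mulye ?leey//.
    by rewrite lte_fin powR_gt0// addr_gt0.
  have fn : f (x n) \is a fin_num by case: (n) => // k; exact: fin.
  rewrite rE// poweR_EFin -!EFinM lee_fin -mulrA.
  apply: le_trans (dist_sqrt _ n fn) _; first by rewrite p_eq2.
  rewrite ler_pM2l//.
  have := dissipative_geometric a0 b0 (diss 0%N f0) n p_eq2.
  rewrite kappaE /= => geo.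
  have k1 : 0 < 1 + kappa by rewrite addr_gt0.
  rewrite -mulNr powRrM -powRM ?powR_ge0 ?rho0//.
  by apply: ge0_ler_powR; rewrite ?nnegrE ?mulr_ge0 ?powR_ge0 ?rho0.
split.
  move=> p_gt2 n.
  have p2 : 0 < p - 2 by rewrite subr_gt0.
  have C1 t : 0 < Cp' `^ t by rewrite powR_gt0.
  have [->|n0] := posnP n.
    by rewrite /eneg_pow eqxx !gt0_muley ?lte_fin ?mulr_gt0// !leey.
  have fn := fin n n0.
  have rn := rate p_gt2 n n0.
  rewrite /eneg_pow pnatr_eq0 gtn_eqF// -!EFinM rE// !lee_fin; split=> //.
  apply: le_trans (dist_root (ltW p_gt2) n fn) _.
  rewrite -mulrA ler_pM2l//.
  have -> : 1 / (p - 2) = p / (p - 2) * p^-1 by field; rewrite !gt_eqF.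
  set q := p / (p - 2) in rn *.
  rewrite -mulNr (powRrM _ q) (powRrM _ (- q)) -powRM ?powR_ge0//.
  by apply: ge0_ler_powR; rewrite ?nnegrE ?mulr_ge0 ?powR_ge0 ?rho0 ?invr_ge0 ?(ltW p0)//.
move=> /andP[r0gt r0lt].
case: (rdich 0%N) => [r0|f0]; first by rewrite r0 ltxx in r0lt.
rewrite rE//= in r0gt *.
have [e1 [e2 e3]] := expl f0 r0gt.
split.
  move=> p2; rewrite e1// baE aE [(_ * rho _) `^ _]powRM ?rho0 ?mulr_ge0 ?(ltW l0)//.
  by ring.
split; first by move=> p2; rewrite e2// baE aE; ring.
exact: e3.
Qed.
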